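(* Let $n\in\mathbb{N}$ and $k,s\in\mathbb{Z}_{\geq 0}$ with $n>k$, and let $\zeta_n$ be a fixed primitive $n$-th root of unity. Then the following two statements are equivalent: (i) for any $d_0,d_1,\ldots,d_s\in\mathbb{Z}_{\geq 0}$ with $2\sum_{j=0}^{s}d_j=k-3s$, it holds $$C_n^2(d_0,d_1,\ldots,d_s)=\frac{(-1)^{d-s}}{n^2}\left[\binom{n+k-d+1}{k+2}+(-1)^s\binom{n+d}{k+2}\right](1-\zeta_n)^k,$$ where $d=\sum_{j=0}^s d_j+s$; (ii) for any $d_0,\ldots,d_s,d_0',\ldots,d_s'\in\mathbb{Z}_{\geq 0}$ with $2\sum_{j=0}^{s}d_j=2\sum_{j=0}^{s}d_j'=k-3s$, it holds $$C_n^2(d_0,d_1,\ldots,d_s)=C_n^2(d_0',d_1',\ldots,d_s').$$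
   Context: $\mathbb{N}$ is the set of positive integers. For $n\in\mathbb{N}$, a complex number $q$ with $q^m\neq 1$ for all $m\in\mathbb{N}$ with $m<n$, and a multi-index $(k_1,\ldots,k_d)\in\mathbb{N}^d$, the finite multiple harmonic $q$-series is $$z_n(k_1,\ldots,k_d;q)=\sum_{n>m_1>\cdots>m_d>0}\frac{q^{(k_1-1)m_1+\cdots+(k_d-1)m_d}}{[m_1]^{k_1}\cdots[m_d]^{k_d}},\qquad [m]=\frac{1-q^m}{1-q},$$ where $m_1,\dots,m_d$ are integers. An empty sum is $0$, and for the empty multi-index ($d=0$) one sets $z_n(\emptyset;q)=1$. The notation $\{a\}^{m}$ means $a$ repeated $m$ times. For $r\in\mathbb{N}$ and $s,d_0,\ldots,d_s\in\mathbb{Z}_{\geq 0}$ the cyclic sum is $$C_n^r(d_0,d_1,\ldots,d_s)=\sum_{j=0}^{s}z_n\left(\{r\}^{d_j},r+1,\{r\}^{d_{j+1}},r+1,\ldots,r+1,\{r\}^{d_{j+s}};\zeta_n\right),$$ where indices of $d$ are read modulo $s+1$ (so $d_j=d_i$ if $j\equiv i$ modulo $s+1$), and in each term the entry $r+1$ occurs exactly $s$ times. Here $r=2$. Binomial coefficients $\binom{a}{b}$ with integers $a\ge 0$ are $0$ if $b<0$ or $b>a$; $0^0=1$. *)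

(* Defs.v *)
From mathcomp Require Import all_boot all_order all_algebra.

Set Implicit Arguments.
Unset Strict Implicit.
Unset Printing Implicit Defensive.

Import GRing.Theory.
Local Open Scope ring_scope.

Definition qnum (F : fieldType) (q : F) (m : nat) : F := (1 - q ^+ m) / (1 - q).

(* The multi-index is the sequence [k]; its entries are meant to be positive,
   so that the truncated subtraction [k_i - 1] is the usual one. The inner
   condition says n > m_1 > ... > m_d > 0. *)
Definition mhqs (F : fieldType) (n : nat) (k : seq nat) (q : F) : F :=
  \sum_(m : (size k).-tuple 'I_n |
        sorted gtn [seq nat_of_ord x | x <- m] && all (fun x : 'I_n => (0 < x)%N) m)
    q ^+ (\sum_(i < size k) (nth 0 k i - 1) * tnth m i)%N
      / \prod_(i < size k) qnum q (tnth m i) ^+ nth 0%N k i.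

(* {r}^{d_j}, r+1, {r}^{d_{j+1}}, r+1, ..., r+1, {r}^{d_{j+s}}; [inZp] reduces
   a natural number modulo s + 1. *)
Definition cyc_index (r s : nat) (d : 'I_s.+1 -> nat) (j : 'I_s.+1) : seq nat :=
  nseq (d j) r ++
  flatten [seq r.+1 :: nseq (d (inZp (j + i))) r | i <- iota 1 s].

Definition cyc_sum (F : fieldType) (n r s : nat) (d : 'I_s.+1 -> nat) (q : F) : F :=
  \sum_(j < s.+1) mhqs n (cyc_index r d j) q.

(* Main.v *)
(** Write D = d_0 + ... + d_s. By (ii) the value of C_n^2 is its average over all
    (d_0, ..., d_s) of sum D, of which there are binomial(D + s, s). Summing over
    these, each of the s + 1 terms of the cyclic sum runs through all words made
    of D letters 2 and s letters 3, so it contributes the coefficient of u^D v^s in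
    prod_(0 < m < n) (1 + u q^m / [m]^2 + v q^(2m) / [m]^3). Up to the powers of
    1 - q and the factor n^3 = prod (1 - q^m)^3, at q = zeta_n this product is
    prod_(0 < m < n) P(q^m), where P(t) = (1 - t)^3 + u t (1 - t) + v t^2
    = (1 - a t)(1 - b t)(1 - c t) with abc = 1. As P(1) = v, multiplying by v gives
    (1 - a^n)(1 - b^n)(1 - c^n) = p_n(1/a, 1/b, 1/c) - p_n(a, b, c)
    for power sums p_n. Differentiating in v turns power sums into complete
    homogeneous sums, whose coefficients are products of two binomials. *)
Require Import Defs.
From mathcomp Require Import all_boot all_order all_algebra.
From mathcomp Require Import ring zify.
From mathcomp Require Import complex reals.
Set Implicit Arguments.
Unset Strict Implicit.
Unset Printing Implicit Defensive.
Import GRing.Theory.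
Local Open Scope ring_scope.

(** * Power sums and complete homogeneous sums by linear recurrence *)

Section LinearRecurrence.
Variable A : comNzRingType.

(** The characteristic polynomial is x^3 - e1 x^2 + e2 x - 1, whose roots have product 1; swapping
    [e1] and [e2] passes to the inverse roots. *)
Fixpoint linrec3 (e1 e2 x0 x1 x2 : A) (n : nat) : A :=
  match n with
  | 0 => x0
  | 1 => x1
  | 2 => x2
  | (((n0.+1) as n1).+1 as n2).+1 =>
      e1 * linrec3 e1 e2 x0 x1 x2 n2 - e2 * linrec3 e1 e2 x0 x1 x2 n1
      + linrec3 e1 e2 x0 x1 x2 n0
  end.

Lemma linrec3S e1 e2 x0 x1 x2 n :
  linrec3 e1 e2 x0 x1 x2 n.+3 =
    e1 * linrec3 e1 e2 x0 x1 x2 n.+2 - e2 * linrec3 e1 e2 x0 x1 x2 n.+1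
    + linrec3 e1 e2 x0 x1 x2 n.
Proof. by []. Qed.

Lemma ind3 (P : nat -> Prop) :
  P 0%N -> P 1%N -> P 2%N -> (forall n, P n -> P n.+1 -> P n.+2 -> P n.+3) ->
  forall n, P n.
Proof.
move=> P0 P1 P2 PS n.
suff [] : [/\ P n, P n.+1 & P n.+2] by [].
by elim: n => [|n [IH0 IH1 IH2]]; split=> //; exact: PS.
Qed.

Lemma linrec3_unique e1 e2 (f : nat -> A) :
  (forall n, f n.+3 = e1 * f n.+2 - e2 * f n.+1 + f n) ->
  forall n, f n = linrec3 e1 e2 (f 0%N) (f 1%N) (f 2%N) n.
Proof. by move=> fS; elim/ind3=> // n H0 H1 H2; rewrite fS linrec3S H0 H1 H2. Qed.

(* Power sums and complete homogeneous sums of three quantities with elementary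
   symmetric functions e1, e2 and 1; [hsum3] is shifted by two, so that
   [hsum3 e1 e2 n.+2] is the homogeneous sum of degree n. *)
Definition psum3 (e1 e2 : A) := linrec3 e1 e2 3%:R e1 (e1 ^+ 2 - 2%:R * e2).
Definition hsum3 (e1 e2 : A) := linrec3 e1 e2 0 0 1.

Lemma psum3_init e1 e2 :
  (psum3 e1 e2 0 = 3%:R) * (psum3 e1 e2 1 = e1)
  * (psum3 e1 e2 2 = e1 ^+ 2 - 2%:R * e2).
Proof. by []. Qed.

Lemma hsum3_init e1 e2 :
  (hsum3 e1 e2 0 = 0) * (hsum3 e1 e2 1 = 0) * (hsum3 e1 e2 2 = 1).
Proof. by []. Qed.

Lemma psum3S e1 e2 n : psum3 e1 e2 n.+3 =
  e1 * psum3 e1 e2 n.+2 - e2 * psum3 e1 e2 n.+1 + psum3 e1 e2 n.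
Proof. by []. Qed.

Lemma hsum3S e1 e2 n : hsum3 e1 e2 n.+3 =
  e1 * hsum3 e1 e2 n.+2 - e2 * hsum3 e1 e2 n.+1 + hsum3 e1 e2 n.
Proof. by []. Qed.

(** At e1 = e2 = 3 the cubic is (x - 1)^3, so only the deviations from 3 disturb the third
    difference. Pascal's rule yields binomials in this form. *)
Lemma hsum3_third_diff e1 e2 n (W := hsum3 e1 e2) :
  W n.+3 = W n.+2 *+ 3 - W n.+1 *+ 3 + W n
           + ((e1 - 3%:R) * W n.+2 - (e2 - 3%:R) * W n.+1).
Proof. by rewrite /W hsum3S; ring. Qed.

(* Newton: sum_n p_n t^n = (3 - 2 e1 t + e2 t^2) / (1 - e1 t + e2 t^2 - t^3). *)
Lemma psum3_hsum3 e1 e2 n : psum3 e1 e2 n =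
  3%:R * hsum3 e1 e2 n.+2 - 2%:R * e1 * hsum3 e1 e2 n.+1 + e2 * hsum3 e1 e2 n.
Proof.
elim/ind3: n => [|||n H0 H1 H2].
- by rewrite psum3_init ?hsum3S !hsum3_init; ring.
- by rewrite psum3_init ?hsum3S !hsum3_init; ring.
- by rewrite psum3_init !hsum3S !hsum3_init; ring.
by rewrite psum3S H0 H1 H2 !hsum3S; ring.
Qed.

End LinearRecurrence.

(** * Derivatives and coefficients of these sums *)

Lemma deriv_natr (B : nzRingType) m : (m%:R : {poly B})^`() = 0.
Proof. by rewrite -polyC_natr derivC. Qed.

(** Formally, this differentiates sum_(n > 0) p_n t^n / n = - log (1 - e1 t + e2 t^2 - t^3); the
    recurrence gives it without dividing by n. *)
Lemma deriv_psum3 (B : comNzRingType) (e1 e2 : {poly B}) n :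
  (psum3 e1 e2 n)^`() =
  n%:R * (e1^`() * hsum3 e1 e2 n.+1 - e2^`() * hsum3 e1 e2 n).
Proof.
elim/ind3: n => [|||n H0 H1 H2].
- by rewrite psum3_init deriv_natr mul0r.
- by rewrite psum3_init ?hsum3S !hsum3_init; ring.
- by rewrite psum3_init !hsum3S !hsum3_init derivB expr2 !derivM deriv_natr; ring.
(* The product rule leaves undifferentiated power sums; Newton's formula turns them into homogeneous
   sums. *)
rewrite psum3S !derivE H0 H1 H2 !psum3_hsum3 !hsum3S.
rewrite -[n.+3]addn3 -[n.+2]addn2 -[n.+1]addn1 !natrD; ring.
Qed.

(* The variables u and v of the header are the inner and the outer indeterminate. *)
Section Coefs.
Variable F : comNzRingType.
Let U : {poly {poly F}} := 'X%:P.
Let V : {poly {poly F}} := 'X.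

Lemma coef_innerXM (p : {poly {poly F}}) a b :
  (U * p)`_b`_a = if a is a'.+1 then p`_b`_a' else 0.
Proof. by rewrite coefCM coefXM; case: a. Qed.

Lemma coef_outerXM (p : {poly {poly F}}) a b :
  (V * p)`_b`_a = if b is b'.+1 then p`_b'`_a else 0.
Proof. by rewrite coefXM; case: b => //=; rewrite coef0. Qed.

(** The generating function in t is t^2 / ((1 - t)^3 + u t (1 - t) + v t^2). Its u^a v^b part is, up
    to sign and 'C(a + b, a), t^(a + 2b + 2) / (1 - t)^(2a + 3b + 3). *)
Lemma coef_hsum3 n a b :
  (hsum3 (3%:R - U) (3%:R - U + V) n)`_b`_a =
  (-1) ^+ (a + b) * 'C(a + b, a)%:R * 'C(n + a + b, 2 * a + 3 * b + 2)%:R.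
Proof.
elim/ind3: n a b => [|||n H0 H1 H2] a b.
- by rewrite coef0 coef0 (@bin_small (0 + _ + _)) ?mulr0 //; lia.
- by rewrite coef0 coef0 (@bin_small (1 + _ + _)) ?mulr0 //; lia.
- rewrite hsum3_init coef1.
  case: a b => [|a] [|b].
  + by rewrite coef1 expr0 !mul1r.
  + by rewrite coef0 (@bin_small (2 + _ + _)) ?mulr0 //; lia.
  + by rewrite coef1 (@bin_small (2 + _ + _)) ?mulr0 //; lia.
  + by rewrite coef0 (@bin_small (2 + _ + _)) ?mulr0 //; lia.
rewrite hsum3_third_diff; set W := hsum3 _ _ in H0 H1 H2 *.
have -> : (3%:R - U - 3%:R) * W n.+2 - (3%:R - U + V - 3%:R) * W n.+1 =
  - (U * (W n.+2 - W n.+1)) - V * W n.+1 by ring.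
rewrite !(coefD, coefN, coefMn) coef_innerXM coef_outerXM.
(* Multiplication by u or v contributes nothing at exponent 0, hence four cases. In the last three,
   [N] and [K] are base indices from which Pascal's rule reaches every binomial. *)
case: a b => [|a] [|b]; rewrite ?coefB ?coefN !(H0, H1, H2).
- have -> : (2 * 0 + 3 * 0 + 2 = 2)%N by [].
  by rewrite !addn0 !binS !bin0 !natrD; ring.
- set N := (n + b.+1)%N; set K := (2 * 0 + 3 * b + 2)%N.
  have -> : (n.+3 + 0 + b.+1 = N.+3)%N by lia.
  have -> : (n.+2 + 0 + b.+1 = N.+2)%N by lia.
  have -> : (n.+1 + 0 + b.+1 = N.+1)%N by lia.
  have -> : (n + 0 + b.+1 = N)%N by lia.
  have -> : (n.+1 + 0 + b = N)%N by lia.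
  have -> : (2 * 0 + 3 * b.+1 + 2 = K.+3)%N by lia.
  by rewrite !bin0 !add0n exprS !binS !natrD; ring.
- set N := (n + a.+1)%N; set K := (2 * a + 1)%N.
  have -> : (n.+3 + a.+1 + 0 = N.+3)%N by lia.
  have -> : (n.+2 + a.+1 + 0 = N.+2)%N by lia.
  have -> : (n.+1 + a.+1 + 0 = N.+1)%N by lia.
  have -> : (n + a.+1 + 0 = N)%N by lia.
  have -> : (n.+2 + a + 0 = N.+1)%N by lia.
  have -> : (n.+1 + a + 0 = N)%N by lia.
  have -> : (2 * a.+1 + 3 * 0 + 2 = K.+3)%N by lia.
  have -> : (2 * a + 3 * 0 + 2 = K.+1)%N by lia.
  rewrite !addn0 !binn exprS !binS !natrD; ring.
- set N := (n + a.+1 + b.+1)%N; set K := (2 * a + 3 * b + 4)%N.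
  have -> : (n.+3 + a.+1 + b.+1 = N.+3)%N by lia.
  have -> : (n.+2 + a.+1 + b.+1 = N.+2)%N by lia.
  have -> : (n.+1 + a.+1 + b.+1 = N.+1)%N by lia.
  have -> : (n.+2 + a + b.+1 = N.+1)%N by lia.
  have -> : (n.+1 + a + b.+1 = N)%N by lia.
  have -> : (n.+1 + a.+1 + b = N)%N by lia.
  have -> : (2 * a.+1 + 3 * b.+1 + 2 = K.+3)%N by lia.
  have -> : (2 * a + 3 * b.+1 + 2 = K.+1)%N by lia.
  have -> : (2 * a.+1 + 3 * b + 2 = K)%N by lia.
  rewrite !addSn !addnS exprS !binS !natrD; ring.
Qed.

(** Here the denominator is (1 - t)^3 + u t (1 - t) - v t: v loses its sign and one power of t. *)
Lemma coef_hsum3_inv n a b :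
  (hsum3 (3%:R - U + V) (3%:R - U) n)`_b`_a =
  (-1) ^+ a * 'C(a + b, a)%:R * 'C(n + a + 2 * b, 2 * a + 3 * b + 2)%:R.
Proof.
elim/ind3: n a b => [|||n H0 H1 H2] a b.
- by rewrite coef0 coef0 (@bin_small (0 + _ + _)) ?mulr0 //; lia.
- by rewrite coef0 coef0 (@bin_small (1 + _ + _)) ?mulr0 //; lia.
- rewrite hsum3_init coef1.
  case: a b => [|a] [|b].
  + by rewrite coef1 expr0 !mul1r.
  + by rewrite coef0 (@bin_small (2 + _ + _)) ?mulr0 //; lia.
  + by rewrite coef1 (@bin_small (2 + _ + _)) ?mulr0 //; lia.
  + by rewrite coef0 (@bin_small (2 + _ + _)) ?mulr0 //; lia.
rewrite hsum3_third_diff; set W := hsum3 _ _ in H0 H1 H2 *.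
have -> : (3%:R - U + V - 3%:R) * W n.+2 - (3%:R - U - 3%:R) * W n.+1 =
  V * W n.+2 - (U * (W n.+2 - W n.+1)) by ring.
rewrite !(coefD, coefN, coefMn) coef_innerXM coef_outerXM.
case: a b => [|a] [|b]; rewrite ?coefB ?coefN !(H0, H1, H2).
- have -> : (2 * 0 + 3 * 0 + 2 = 2)%N by [].
  by rewrite !addn0 !binS !bin0 !natrD; ring.
- set N := (n + 2 * b.+1)%N; set K := (2 * 0 + 3 * b + 2)%N.
  have -> : (n.+3 + 0 + 2 * b.+1 = N.+3)%N by lia.
  have -> : (n.+2 + 0 + 2 * b.+1 = N.+2)%N by lia.
  have -> : (n.+1 + 0 + 2 * b.+1 = N.+1)%N by lia.
  have -> : (n + 0 + 2 * b.+1 = N)%N by lia.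
  have -> : (n.+2 + 0 + 2 * b = N)%N by lia.
  have -> : (2 * 0 + 3 * b.+1 + 2 = K.+3)%N by lia.
  by rewrite !bin0 !binS !natrD; ring.
- set N := (n + a.+1)%N; set K := (2 * a + 1)%N.
  have -> : (n.+3 + a.+1 + 2 * 0 = N.+3)%N by lia.
  have -> : (n.+2 + a.+1 + 2 * 0 = N.+2)%N by lia.
  have -> : (n.+1 + a.+1 + 2 * 0 = N.+1)%N by lia.
  have -> : (n + a.+1 + 2 * 0 = N)%N by lia.
  have -> : (n.+2 + a + 2 * 0 = N.+1)%N by lia.
  have -> : (n.+1 + a + 2 * 0 = N)%N by lia.
  have -> : (2 * a.+1 + 3 * 0 + 2 = K.+3)%N by lia.
  have -> : (2 * a + 3 * 0 + 2 = K.+1)%N by lia.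
  rewrite !addn0 !binn exprS !binS !natrD; ring.
- set N := (n + a.+1 + 2 * b.+1)%N; set K := (2 * a + 3 * b + 4)%N.
  have -> : (n.+3 + a.+1 + 2 * b.+1 = N.+3)%N by lia.
  have -> : (n.+2 + a.+1 + 2 * b.+1 = N.+2)%N by lia.
  have -> : (n.+1 + a.+1 + 2 * b.+1 = N.+1)%N by lia.
  have -> : (n.+2 + a + 2 * b.+1 = N.+1)%N by lia.
  have -> : (n.+1 + a + 2 * b.+1 = N)%N by lia.
  have -> : (n.+2 + a.+1 + 2 * b = N)%N by lia.
  have -> : (2 * a.+1 + 3 * b.+1 + 2 = K.+3)%N by lia.
  have -> : (2 * a + 3 * b.+1 + 2 = K.+1)%N by lia.
  have -> : (2 * a.+1 + 3 * b + 2 = K)%N by lia.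
  rewrite !addSn !addnS exprS !binS !natrD; ring.
Qed.

End Coefs.

(** * Products over roots of unity as determinants *)

Section Determinant.
Variable A : comNzRingType.

(* Entries indexed by naturals make 3 x 3 expansions compute. *)
Definition mx33 (g : nat -> nat -> A) : 'M[A]_3 := \matrix_(i, j) g i j.

Lemma mx33E (N : 'M[A]_3) : N = mx33 (fun i j => N (inord i) (inord j)).
Proof. by apply/matrixP=> i j; rewrite mxE !inord_val. Qed.

Lemma det_mx33 g : \det (mx33 g) =
  g 0 0 * (g 1 1 * g 2 2 - g 1 2 * g 2 1)
  - g 0 1 * (g 1 0 * g 2 2 - g 1 2 * g 2 0)
  + g 0 2 * (g 1 0 * g 2 1 - g 1 1 * g 2 0).
Proof.
rewrite (expand_det_row _ 0) !big_ord_recl big_ord0 /cofactor.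
rewrite !(expand_det_row _ 0) !big_ord_recl !big_ord0 /cofactor !det_mx11.
by rewrite !mxE /= /bump /=; ring.
Qed.

Lemma tr_mx33 g : \tr (mx33 g) = g 0 0 + g 1 1 + g 2 2.
Proof. by rewrite /mxtrace !big_ord_recl big_ord0 !mxE /= /bump /= addr0 addrA. Qed.

Lemma tr_adj_mx33 g : \tr (\adj (mx33 g)) =
  g 1 1 * g 2 2 - g 1 2 * g 2 1 + (g 0 0 * g 2 2 - g 0 2 * g 2 0)
  + (g 0 0 * g 1 1 - g 0 1 * g 1 0).
Proof.
rewrite /mxtrace !big_ord_recl big_ord0 !mxE /cofactor.
rewrite !(expand_det_row _ 0) !big_ord_recl !big_ord0 /cofactor !det_mx11.
by rewrite !mxE /= /bump /=; ring.
Qed.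

(** The value at x = 1 of det (N - x) = det N - tr (adj N) x + tr N x^2 - x^3, where adj N is the
    inverse since det N = 1. *)
Lemma det_sub1 (N N' : 'M[A]_3) :
  \det N = 1 -> N * N' = 1 -> \det (N - 1) = \tr N - \tr N'.
Proof.
move=> detN NN'.
have -> : N' = \adj N.
  by rewrite -[LHS]mul1r -[1]/(1%:M) -detN -mul_adj_mx -mulrA NN' mulr1.
move: detN; rewrite [N]mx33E; set g := fun _ _ => _.
have -> : mx33 g - 1 = mx33 (fun i j => g i j - (i == j)%:R).
  by apply/matrixP=> i j; rewrite !mxE.
rewrite !det_mx33 tr_mx33 tr_adj_mx33 /= => detN.
(* Adding det N - 1 = 0 to the right side makes the goal a polynomial identity in the nine
   entries. *)
by rewrite -[RHS]add0r -[X in _ = X + _](subrr 1) -[X in _ = X - 1 + _]detN; ring.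
Qed.

Variables e1 e2 : A.

(* Companion matrix of x^3 - e1 x^2 + e2 x - 1. *)
Definition cubic_mx : 'M[A]_3 :=
  mx33 (fun i j => nth 0 (nth [::] [:: [:: 0; 1; 0]; [:: 0; 0; 1]; [:: 1; - e2; e1]] i) j).
Definition cubic_mx_inv : 'M[A]_3 :=
  mx33 (fun i j => nth 0 (nth [::] [:: [:: e2; - e1; 1]; [:: 1; 0; 0]; [:: 0; 1; 0]] i) j).

Lemma mulmx33 g h :
  mx33 g * mx33 h = mx33 (fun i j => g i 0 * h 0 j + g i 1 * h 1 j + g i 2 * h 2 j).
Proof.
by apply/matrixP=> i j; rewrite !mxE !big_ord_recl big_ord0 !mxE /= addr0 addrA.
Qed.

Lemma cubic_mxV : cubic_mx * cubic_mx_inv = 1.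
Proof.
rewrite mulmx33; apply/matrixP=> i j; rewrite !mxE.
by case: i => [[|[|[|]]]] // ? ; case: j => [[|[|[|]]]] //= ?; rewrite -?val_eqE /=; ring.
Qed.

Lemma det_cubic_mx x : \det (cubic_mx - x%:M) = 1 - e2 * x + e1 * x ^+ 2 - x ^+ 3.
Proof.
have -> : cubic_mx - x%:M = mx33 (fun i j =>
   nth 0 (nth [::] [:: [:: 0; 1; 0]; [:: 0; 0; 1]; [:: 1; - e2; e1]] i) j - x *+ (i == j)).
  by apply/matrixP=> i j; rewrite !mxE.
by rewrite det_mx33 /=; ring.
Qed.

Lemma cubic_mx3 : cubic_mx ^+ 3 = e1 *: cubic_mx ^+ 2 - e2 *: cubic_mx + 1.
Proof.
rewrite 2!exprS expr1 !mulmx33; apply/matrixP=> i j.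
rewrite !mxE.
by case: i => [[|[|[|]]]] // ? ; case: j => [[|[|[|]]]] //= ?; rewrite -?val_eqE /=; ring.
Qed.

Lemma cubic_mx_inv3 :
  cubic_mx_inv ^+ 3 = e2 *: cubic_mx_inv ^+ 2 - e1 *: cubic_mx_inv + 1.
Proof.
rewrite 2!exprS expr1 !mulmx33; apply/matrixP=> i j.
rewrite !mxE.
by case: i => [[|[|[|]]]] // ? ; case: j => [[|[|[|]]]] //= ?; rewrite -?val_eqE /=; ring.
Qed.

Lemma tr_exp_psum3 (M : 'M[A]_3) (a b : A) :
  M ^+ 3 = a *: M ^+ 2 - b *: M + 1 -> \tr M = a -> \tr (M ^+ 2) = a ^+ 2 - 2%:R * b ->
  forall n, \tr (M ^+ n) = psum3 a b n.
Proof.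
move=> M3 tM tM2 n.
rewrite (@linrec3_unique _ a b (fun m => \tr (M ^+ m))) => [|m].
  by rewrite expr0 expr1 mxtrace1 tM tM2.
by rewrite -[m.+3]addn3 exprD M3 mulrDr mulrBr mulr1 -!scalerAr -exprD -exprSr addn2
   mxtraceD raddfB /= !mxtraceZ.
Qed.

Lemma tr_cubic_mx n : \tr (cubic_mx ^+ n) = psum3 e1 e2 n.
Proof.
apply: (tr_exp_psum3 cubic_mx3).
  by rewrite tr_mx33 /= !add0r.
by rewrite expr2 mulmx33 tr_mx33 /=; ring.
Qed.

Lemma tr_cubic_mx_inv n : \tr (cubic_mx_inv ^+ n) = psum3 e2 e1 n.
Proof.
apply: (tr_exp_psum3 cubic_mx_inv3).
  by rewrite tr_mx33 /= !addr0.
by rewrite expr2 mulmx33 tr_mx33 /=; ring.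
Qed.

Lemma det_exp (M : 'M[A]_3) n : \det (M ^+ n) = \det M ^+ n.
Proof. by elim: n => [|n IH]; rewrite ?expr0 ?det1 // !exprS det_mulmx IH. Qed.

(** This expands (x1^n - 1)(x2^n - 1)(x3^n - 1) for the roots of the cubic. Matrix traces stand in
    for roots, which [A] need not contain. *)
Lemma det_cubic_mx_exp n : \det (cubic_mx ^+ n - 1) = psum3 e1 e2 n - psum3 e2 e1 n.
Proof.
rewrite -tr_cubic_mx -tr_cubic_mx_inv; apply: det_sub1.
  have := det_cubic_mx 0; rewrite raddf0 subr0 det_exp => ->.
  by rewrite mulr0 !expr0n /= mulr0 !subr0 addr0 expr1n.
rewrite -exprMn_comm ?cubic_mxV ?expr1n //.
have VV : cubic_mx_inv *m cubic_mx = 1%:M by apply: mulmx1C; exact: cubic_mxV.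
by rewrite /GRing.comm cubic_mxV.
Qed.

(** Evaluate X^n - 1 = prod (X - z^i) at the companion matrix and take determinants. *)
Lemma prod_cubic_unity (F : fieldType) (f : {rmorphism F -> A}) n (z : F) :
  n.-primitive_root z ->
  \prod_(0 <= i < n)
     (1 - e2 * f (z ^+ i) + e1 * f (z ^+ i) ^+ 2 - f (z ^+ i) ^+ 3) =
  psum3 e1 e2 n - psum3 e2 e1 n.
Proof.
move=> prim_z; rewrite -det_cubic_mx_exp.
have := congr1 (horner_mx cubic_mx \o map_poly f) (factor_Xn_sub_1 prim_z).
rewrite /= !(rmorph_prod, rmorphB, rmorphXn, rmorph1) /= map_polyX horner_mx_X => <-.
rewrite (big_morph _ (@det_mulmx A 3) (det1 _ _)).
apply: eq_bigr => i _.
by rewrite rmorphB /= map_polyX map_polyC /= rmorphB /= horner_mx_X horner_mx_C det_cubic_mx.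
Qed.

End Determinant.

(** * Multiple harmonic sums as iterated sums *)

Lemma big_tuple_cons (V : nmodType) (T : finType) m (P : pred (m.+1.-tuple T))
    (f : m.+1.-tuple T -> V) :
  \sum_(t | P t) f t =
  \sum_(x : T) \sum_(t : m.-tuple T | P [tuple of x :: t]) f [tuple of x :: t].
Proof.
rewrite pair_big_dep /=.
rewrite (reindex (fun p : T * m.-tuple T => [tuple of p.1 :: p.2])) //=.
exists (fun t => (thead t, [tuple of behead t])) => [[x t] _ | t _] /=.
  by rewrite theadE; congr pair; apply: val_inj.
by rewrite -tuple_eta.
Qed.

Section NestedSums.
Variables (F : fieldType) (w : nat -> nat -> F).

Fixpoint nested_sum (k : seq nat) (b : nat) : F :=
  if k is a :: k' then \sum_(1 <= i < b) w a i * nested_sum k' i else 1.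

Lemma nested_sumS a k b : (0 < b)%N ->
  nested_sum (a :: k) b.+1 = nested_sum (a :: k) b + w a b * nested_sum k b.
Proof. by move=> b_gt0; rewrite /= big_nat_recr. Qed.

(** The bound [b] is kept apart from [N] because the induction lowers it to the index just chosen
    while the tuples stay in 'I_N. *)
Lemma nested_sumE N k b : (b <= N)%N ->
  \sum_(m : (size k).-tuple 'I_N |
      path gtn b [seq nat_of_ord x | x <- m] && all (fun x : 'I_N => (0 < x)%N) m)
    \prod_(i < size k) w (nth 0%N k i) (tnth m i) = nested_sum k b.
Proof.
elim: k b => [|a k IH] b le_bN /=.
  rewrite (big_pred1 [tuple]) ?big_ord0 // => t.
  by rewrite [t]tuple0 /= eqxx.
rewrite big_tuple_cons /=.
rewrite (big_nat_widen _ _ N) // big_geq_mkord [RHS]big_mkcond /=.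
apply: eq_bigr => x _; case: ifP => [/andP[lt_xb x_gt0]|not_x]; last first.
  by rewrite big_pred0 // => t; rewrite andbACA not_x.
rewrite -IH ?(ltnW (ltn_ord x)) // big_distrr /=.
apply: eq_big => [t|t _]; first by rewrite lt_xb x_gt0.
by rewrite big_ord_recl /=; congr (_ * _); apply: eq_bigr => i _; rewrite !(tnth_nth x).
Qed.

End NestedSums.

Lemma eq_nested_sum (F : fieldType) (w w' : nat -> nat -> F) k b :
  w =2 w' -> nested_sum w k b = nested_sum w' k b.
Proof.
move=> eq_w; elim: k b => //= a k IH b.
by apply: eq_bigr => i _; rewrite eq_w IH.
Qed.

Lemma nested_sum_scale (F : fieldType) (w : nat -> nat -> F) c k b :
  nested_sum (fun a i => c ^+ a * w a i) k b = c ^+ sumn k * nested_sum w k b.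
Proof.
elim: k b => [|a k IH] b /=; first by rewrite mulr1.
rewrite mulr_sumr; apply: eq_bigr => i _.
by rewrite IH exprD mulrACA.
Qed.

Lemma mhqs_nested_sum (F : fieldType) n k (q : F) :
  mhqs n k q = nested_sum (fun a i => q ^+ ((a - 1) * i) / qnum q i ^+ a) k n.
Proof.
rewrite -(@nested_sumE _ _ n) // /mhqs; apply: eq_big => [m|m _].
  by case: m => [[|x m] ?] //=; rewrite ltn_ord.
by rewrite big_split /= prodfV prodrXr.
Qed.

(** * Weak compositions, words in two letters, and their generating product *)

(** The recursion mirrors the first letter of the associated word: a leading part 0 gives the letter
    r + 1, a positive one gives r. *)
Fixpoint compositions (s : nat) : nat -> seq (seq nat) :=
  if s is s'.+1 then
    fix c D := [seq 0%N :: l | l <- compositions s' D] ++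
      (if D is D'.+1 then [seq (head 0%N l).+1 :: behead l | l <- c D'] else [::])
  else fun D => [:: [:: D]].

Lemma compositionsSS s D : compositions s.+1 D.+1 =
  [seq 0%N :: l | l <- compositions s D.+1] ++
  [seq (head 0%N l).+1 :: behead l | l <- compositions s.+1 D].
Proof. by []. Qed.

Lemma compositionsS0 s : compositions s.+1 0 = [seq 0%N :: l | l <- compositions s 0].
Proof. by rewrite /= cats0. Qed.

Lemma mem_compositions s D l :
  (l \in compositions s D) = (size l == s.+1) && (sumn l == D).
Proof.
elim: s D l => [|s IHs] D l.
  by case: l => [|x [|y l]]; rewrite inE ?eqseq_cons /= ?addn0 ?andbT ?andbF.
elim: D l => [|D IHD] l.
  rewrite compositionsS0; apply/mapP/idP => [[l' + ->] | ].
    by rewrite IHs /=.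
  case: l => [|x l] //= /andP[sl]; rewrite addn_eq0 => /andP[/eqP -> sum0].
  by exists l => //; rewrite IHs -eqSS sl.
rewrite compositionsSS mem_cat; apply/orP/idP => [[] /mapP[l' + ->] | ].
- by rewrite IHs /=.
- by rewrite IHD; case: l' => [|x l'] //=; rewrite addSn eqSS.
case: l => [|[|x] l] //= /andP[sl suml].
  by left; apply/mapP; exists l => //; rewrite IHs -eqSS sl.
by right; apply/mapP; exists (x :: l) => //; rewrite IHD /= sl -eqSS -addSn.
Qed.

Lemma uniq_compositions s D : uniq (compositions s D).
Proof.
elim: s D => [|s IHs] // D.
have cons_inj : injective (cons 0%N) by move=> l l' [].
elim: D => [|D IHD]; first by rewrite compositionsS0 map_inj_uniq.
rewrite compositionsSS cat_uniq map_inj_uniq // IHs andTb; apply/andP; split.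
  by apply/hasPn => l /mapP[l' _ ->]; apply/mapP => -[].
(* Because of the default in [head], the empty list and [:: 0] have the same image; injectivity
   holds on nonempty lists only. *)
rewrite map_inj_in_uniq // => -[|x l] [|y l']; rewrite !mem_compositions //=.
by move=> _ _ [-> ->].
Qed.

Lemma size_compositions s D : size (compositions s D) = 'C(D + s, s).
Proof.
elim: s D => [|s IHs] D; first by rewrite bin0.
elim: D => [|D IHD]; first by rewrite compositionsS0 size_map IHs !add0n !binn.
by rewrite compositionsSS size_cat !size_map IHs IHD [in RHS]addSn binS addnC addSnnS.
Qed.

Definition interleave (r : nat) (l : seq nat) : seq nat :=
  if l is x :: l' then nseq x r ++ flatten [seq r.+1 :: nseq y r | y <- l'] else [::].

Definition words (r D s : nat) := [seq interleave r l | l <- compositions s D].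

Lemma words0S r s : words r 0 s.+1 = [seq r.+1 :: k | k <- words r 0 s].
Proof.
rewrite /words compositionsS0 -!map_comp; apply/eq_in_map => l.
by rewrite mem_compositions; case: l.
Qed.

Lemma wordsS0 r D : words r D.+1 0 = [seq r :: k | k <- words r D 0].
Proof. by []. Qed.

Lemma wordsSS r D s : words r D.+1 s.+1 =
  [seq r.+1 :: k | k <- words r D.+1 s] ++ [seq r :: k | k <- words r D s.+1].
Proof.
rewrite /words compositionsSS map_cat -!map_comp; congr cat.
all: by apply/eq_in_map => l; rewrite mem_compositions; case: l.
Qed.

Lemma cyc_indexE r s (d : 'I_s.+1 -> nat) (j : 'I_s.+1) :
  cyc_index r d j = interleave r [seq d (inZp (j + i)) | i <- iota 0 s.+1].
Proof. by rewrite /cyc_index /= addn0 valZpK -map_comp. Qed.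

Lemma cyc_index_nth r s l (j : 'I_s.+1) : size l = s.+1 ->
  cyc_index r (fun i : 'I_s.+1 => nth 0%N l i) j = interleave r (rot j l).
Proof.
move=> sl; rewrite cyc_indexE; congr interleave.
apply: (@eq_from_nth _ 0%N) => [|i]; first by rewrite size_map size_iota size_rot.
rewrite size_map size_iota => lt_is.
rewrite (nth_map 0%N) ?size_iota // nth_iota // add0n /= /rot nth_cat size_drop sl.
have lt_js := ltn_ord j.
(* The positions with j + i at least s + 1 wrap around exactly once. *)
case: ltnP => [lt_i|le_i]; first by rewrite nth_drop modn_small //; lia.
rewrite nth_take; last by lia.
have -> : (j + i = (j + i - s.+1) + s.+1)%N by lia.
by rewrite modnDr modn_small; [congr nth|]; lia.
Qed.

(* Rotations permute the compositions, so all the terms of the cyclic sum have the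
   same total. *)
Lemma sum_cyc_sum (F : fieldType) n r D s (q : F) :
  \sum_(l <- compositions s D) cyc_sum n r (fun i : 'I_s.+1 => nth 0%N l i) q =
  s.+1%:R * \sum_(k <- words r D s) mhqs n k q.
Proof.
rewrite /cyc_sum exchange_big /= mulr_natl -[s.+1 in RHS]card_ord -sumr_const.
apply: eq_bigr => j _; rewrite /words big_map.
have -> : \sum_(l <- compositions s D) mhqs n (interleave r l) q =
  \sum_(l <- [seq rot j l | l <- compositions s D]) mhqs n (interleave r l) q.
  apply: perm_big; apply: uniq_perm; rewrite ?uniq_compositions //.
    by rewrite map_inj_uniq ?uniq_compositions //; apply: rot_inj.
  move=> l; apply/idP/mapP => [|[l' + ->]].
    rewrite mem_compositions => ml; exists (rotr j l); last by rewrite rotrK.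
    by rewrite mem_compositions size_rotr (@perm_sumn _ l) ?perm_rotr.
  by rewrite !mem_compositions size_rot (@perm_sumn _ l') ?perm_rot.
rewrite big_map; apply: eq_big_seq => l; rewrite mem_compositions => /andP[/eqP sl _].
by rewrite cyc_index_nth.
Qed.

Lemma sumn_words r D s k : k \in words r D s -> sumn k = (r * D + r.+1 * s)%N.
Proof.
elim: s D k => [|s IHs]; elim=> [|D IHD] k.
- by rewrite inE => /eqP ->; rewrite !muln0.
- by rewrite wordsS0 => /mapP[k' /IHD sumk' ->] /=; rewrite sumk'; lia.
- by rewrite words0S => /mapP[k' /IHs sumk' ->] /=; rewrite sumk'; lia.
- rewrite wordsSS mem_cat => /orP[] /mapP[k' k'_in ->] /=.
    by rewrite (IHs _ _ k'_in); lia.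
  by rewrite (IHD _ k'_in); lia.
Qed.

(** Each factor selects no letter, r or r + 1 at its index. Indices decrease along a word, so the
    factor added last can only supply the first letter. *)
Lemma coef_prod_words (F : fieldType) (w : nat -> nat -> F) r D s b : (0 < b)%N ->
  (\prod_(1 <= i < b) (1 + 'X%:P * (w r i)%:P%:P + 'X * (w r.+1 i)%:P%:P))`_s`_D =
  \sum_(k <- words r D s) nested_sum w k b.
Proof.
case: b => // b _; elim: b D s => [|b IH] D s.
  rewrite big_geq // coef1; case: D s => [|D] [|s].
  - by rewrite coef1 big_seq1.
  - rewrite coef0 words0S big_map big1 // => k _ /=; exact: big_geq.
  - rewrite coef1 wordsS0 big_map big1 // => k _ /=; exact: big_geq.
  - rewrite coef0 wordsSS big_cat /= !big_map !big1 ?addr0 // => k _ /=; exact: big_geq.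
rewrite big_nat_recr //= mulrDr mulrDr mulr1.
set P := bigop _ _ _ in IH *.
have -> : P * ('X%:P * (w r b.+1)%:P%:P) = 'X%:P * ((w r b.+1)%:P%:P * P) by ring.
have -> : P * ('X * (w r.+1 b.+1)%:P%:P) = 'X * ((w r.+1 b.+1)%:P%:P * P) by ring.
rewrite !coefD coef_innerXM coef_outerXM.
have coefP x t d : (x%:P%:P * P)`_t`_d = x * P`_t`_d by rewrite !coefCM.
have rec a S : \sum_(k <- [seq a :: k | k <- S]) nested_sum w k b.+2 =
    \sum_(k <- [seq a :: k | k <- S]) nested_sum w k b.+1
    + w a b.+1 * \sum_(k <- S) nested_sum w k b.+1.
  by rewrite !big_map mulr_sumr -big_split; apply: eq_bigr => k _; rewrite nested_sumS.
case: D s => [|D] [|s]; rewrite ?coefP !IH ?coef0 ?addr0.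
- by rewrite !big_seq1.
- by rewrite words0S rec -words0S.
- by rewrite wordsS0 rec -wordsS0.
- rewrite wordsSS !big_cat /= !rec; ring.
Qed.

(** * Evaluation at a primitive root of unity *)

Section RootOfUnity.
Variables (F : numFieldType) (n : nat) (z : F).
Hypothesis prim_z : n.-primitive_root z.

Let n_gt0 : (0 < n)%N := prim_order_gt0 prim_z.

(** Compare the factored and expanded forms of (X^n - 1) / (X - 1) at 1. *)
Lemma prod_1_sub_unity : \prod_(1 <= i < n) (1 - z ^+ i) = n%:R.
Proof.
have := factor_Xn_sub_1 prim_z; rewrite big_ltn // expr0 subrX1.
have X1_neq0 : ('X - 1%:P : {poly F}) != 0 by rewrite polyXsubC_eq0.
move/(mulfI X1_neq0)/(congr1 (fun p => p.[1])).
rewrite horner_prod horner_sum => E.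
transitivity (\prod_(1 <= i < n) ('X - (z ^+ i)%:P).[1]).
  by apply: eq_bigr => i _; rewrite hornerXsubC.
rewrite E (eq_bigr (fun=> 1)) => [|i _]; last by rewrite hornerXn expr1n.
by rewrite sumr_const card_ord.
Qed.

Lemma prim_root_neq1 i : (0 < i < n)%N -> z ^+ i != 1.
Proof.
case/andP=> i_gt0 lt_in; rewrite -(prim_order_dvd prim_z).
by apply/negP => /(dvdn_leq i_gt0); rewrite leqNgt lt_in.
Qed.

(** The factor s + 1 comes from differentiating v P in v. *)
Lemma mulr_coef_prod_unity D s :
  s.+1%:R * (\prod_(1 <= i < n)
     (((1 - z ^+ i) ^+ 3)%:P%:P + 'X%:P * (z ^+ i * (1 - z ^+ i))%:P%:P
      + 'X * ((z ^+ i) ^+ 2)%:P%:P))`_s`_D =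
  n%:R * ((-1) ^+ D * 'C(D + s, D)%:R *
    ('C(n + D + 2 * s + 1, 2 * D + 3 * s + 2)%:R
     + (-1) ^+ s * 'C(n + D + s, 2 * D + 3 * s + 2)%:R)) :> F.
Proof.
set P := bigop _ _ _.
set U : {poly {poly F}} := 'X%:P; set V : {poly {poly F}} := 'X.
(* The missing factor i = 0 is the cubic at 1, which equals v. *)
have XP : V * P = psum3 (3%:R - U + V) (3%:R - U) n - psum3 (3%:R - U) (3%:R - U + V) n.
  rewrite -(prod_cubic_unity _ _ (polyC \o polyC) prim_z) big_ltn //; congr (_ * _).
    by rewrite expr0 rmorph1; ring.
  apply: eq_bigr => i _.
  rewrite /= -/U -/V !(polyCM, polyCB, polyC_exp, polyC1).
  by move: (z%:P%:P ^+ i) => x; ring.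
(* The derivative is in the outer variable v, so 3 - u is constant and 3 - u + v has derivative
   1. *)
have := congr1 (fun p : {poly {poly F}} => (p^`())`_s`_D) XP.
rewrite coef_deriv coefXM /= coefMn mulr_natl => ->.
have dU : (3%:R - U)^`() = 0 by rewrite derivB deriv_natr derivC subr0.
have dUV : (3%:R - U + V)^`() = 1 by rewrite derivD dU derivX add0r.
rewrite derivB !deriv_psum3 dU dUV !mul0r !mul1r subr0 sub0r mulrN opprK -mulrDr.
rewrite -[n%:R]polyC_natr -[n%:R]polyC_natr !coefCM.
rewrite !coefD coef_hsum3_inv coef_hsum3; congr (_ * _).
have -> : (n.+1 + D + 2 * s = n + D + 2 * s + 1)%N by lia.
by rewrite exprD; ring.
Qed.

(** Clearing denominators costs n^3 and the derivative of the power sums returns n, whence the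
    denominator n^2. *)
Lemma sum_words_mhqs D s :
  s.+1%:R * \sum_(k <- words 2 D s) mhqs n k z =
  (-1) ^+ D * 'C(D + s, s)%:R / n%:R ^+ 2 *
    ('C(n + D + 2 * s + 1, 2 * D + 3 * s + 2)%:R
     + (-1) ^+ s * 'C(n + D + s, 2 * D + 3 * s + 2)%:R) * (1 - z) ^+ (2 * D + 3 * s).
Proof.
have nF0 : n%:R != 0 :> F by rewrite Num.Theory.pnatr_eq0 -lt0n.
(* This weight omits the factor (1 - z)^a of 1 / [i]^a; over a word these factors multiply to a
   power depending only on its weight. *)
pose w a i := z ^+ ((a - 1) * i) / (1 - z ^+ i) ^+ a.
have -> : \sum_(k <- words 2 D s) mhqs n k z =
    (1 - z) ^+ (2 * D + 3 * s) * \sum_(k <- words 2 D s) nested_sum w k n.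
  rewrite mulr_sumr; apply: eq_big_seq => k /sumn_words <-.
  rewrite mhqs_nested_sum -nested_sum_scale; apply: eq_nested_sum => a i.
  by rewrite /w /qnum expr_div_n invf_div mulrCA mulrA.
rewrite -coef_prod_words //.
have := mulr_coef_prod_unity D s.
have -> : \prod_(1 <= i < n)
     (((1 - z ^+ i) ^+ 3)%:P%:P + 'X%:P * (z ^+ i * (1 - z ^+ i))%:P%:P
      + 'X * ((z ^+ i) ^+ 2)%:P%:P) =
   (n%:R ^+ 3)%:P%:P *
   \prod_(1 <= i < n) (1 + 'X%:P * (w 2 i)%:P%:P + 'X * (w 3 i)%:P%:P).
  rewrite -prod_1_sub_unity -prodrXl !rmorph_prod -big_split /=.
  rewrite !big_nat; apply: eq_bigr => i i_n.
  have zi : 1 - z ^+ i != 0 by rewrite subr_eq0 eq_sym prim_root_neq1.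
  have -> : z ^+ i * (1 - z ^+ i) = (1 - z ^+ i) ^+ 3 * w 2 i.
    by rewrite /w mul1n; field.
  have -> : (z ^+ i) ^+ 2 = (1 - z ^+ i) ^+ 3 * w 3 i.
    by rewrite /w mulnC exprM; field.
  by rewrite !rmorphM /=; ring.
rewrite !coefCM; set G := _`_D; set B := (_ + _ * 'C(_, _)%:R) => E.
have -> : 'C(D + s, s) = 'C(D + s, D) by rewrite -[in LHS]bin_sub ?leq_addl // addnK.
apply: (mulfI (expf_neq0 3 nF0)).
have {}E : n%:R ^+ 3 * (s.+1%:R * G) = n%:R * ((-1) ^+ D * 'C(D + s, D)%:R * B).
  by rewrite -E; ring.
transitivity ((1 - z) ^+ (2 * D + 3 * s) * (n%:R ^+ 3 * (s.+1%:R * G))); first by ring.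
by rewrite E; field.
Qed.

(** A constant cyclic sum equals its average over all compositions; their number is invertible in
    characteristic 0. *)
Lemma cyc_sum_formula s (e : 'I_s.+1 -> nat) (D := (\sum_(j < s.+1) e j)%N) :
  (forall e' : 'I_s.+1 -> nat, (\sum_(j < s.+1) e' j)%N = D ->
     cyc_sum n 2 e z = cyc_sum n 2 e' z) ->
  cyc_sum n 2 e z = (-1) ^+ D / n%:R ^+ 2 *
    ('C(n + D + 2 * s + 1, 2 * D + 3 * s + 2)%:R
     + (-1) ^+ s * 'C(n + D + s, 2 * D + 3 * s + 2)%:R) * (1 - z) ^+ (2 * D + 3 * s).
Proof.
move=> cyc_const.
have C_neq0 : 'C(D + s, s)%:R != 0 :> F.
  by rewrite Num.Theory.pnatr_eq0 -lt0n bin_gt0 leq_addl.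
apply: (mulfI C_neq0); rewrite mulr_natl.
transitivity (s.+1%:R * \sum_(k <- words 2 D s) mhqs n k z); last first.
  by rewrite sum_words_mhqs; ring.
rewrite -sum_cyc_sum -size_compositions big_seq.
rewrite (eq_bigr (fun=> cyc_sum n 2 e z)) => [|l].
  by rewrite -big_seq big_const_seq count_predT iter_addr_0.
rewrite mem_compositions => /andP[/eqP sl /eqP suml]; symmetry; apply: cyc_const.
by rewrite -suml sumnE (big_nth 0%N) sl big_mkord.
Qed.

End RootOfUnity.

Theorem corollary1p5 (R : realType) (n k s : nat) (hn : (0 < n)%N)
    (hkn : (k < n)%N) (zeta : R[i]) (hzeta : n.-primitive_root zeta) :
  (forall e : 'I_s.+1 -> nat,
     (2 * \sum_(j < s.+1) e j)%N%:Z = k%:Z - (3 * s)%N%:Z ->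
     let d := (\sum_(j < s.+1) e j + s)%N in
     cyc_sum n 2 e zeta =
       (-1) ^+ (d - s) / n%:R ^+ 2
       * ('C(n + k - d + 1, k + 2)%:R + (-1) ^+ s * 'C(n + d, k + 2)%:R)
       * (1 - zeta) ^+ k)
  <->
  (forall e e' : 'I_s.+1 -> nat,
     (2 * \sum_(j < s.+1) e j)%N%:Z = k%:Z - (3 * s)%N%:Z ->
     (2 * \sum_(j < s.+1) e' j)%N%:Z = k%:Z - (3 * s)%N%:Z ->
     cyc_sum n 2 e zeta = cyc_sum n 2 e' zeta).
Proof.
split=> [formula e e' sum_e sum_e' | cyc_const e sum_e d].
  have eq_sum : (\sum_(j < s.+1) e j = \sum_(j < s.+1) e' j)%N by lia.
  by rewrite (formula e) // (formula e') // eq_sum.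
rewrite (cyc_sum_formula hzeta) => [|e' sum_e']; last first.
  by apply: cyc_const; rewrite ?sum_e'.
rewrite /d; set D := (\sum_(j < s.+1) e j)%N in sum_e *.
(* As k - d = D + 2s is nonnegative, the truncated subtraction is exact. *)
have -> : k = (2 * D + 3 * s)%N by lia.
have -> : (n + (2 * D + 3 * s) - (D + s) + 1 = n + D + 2 * s + 1)%N by lia.
by rewrite addnK addnA.
Qed.
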